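(* Let $a,b>0$, and put $p:=a/(a+b)$ and $c_{a,b}:=(a+b)/(a+1)$. For $x\in[0,1)$ let \[ Q_{a,b}(x):=a\int_0^1 y^{a-1}(1-xy)^{b-1}\,\mathrm{d}y, \] \[ Q_{a,b}^{[S,1]}(x):=(1-x)^b\Bigl(1+\frac{c_{a,b}x}{1-x}\Bigr), \qquad Q_{a,b}^{[S,2]}(x):=\begin{cases}\dfrac{(1-x)^b}{1-c_{a,b}x} & \text{if } x\in[0,p],\\[1ex] (a+1)(1-p)^b & \text{if } x\in[p,1).\end{cases} \] Then for every $x\in[0,1)$: \begin{itemize} \item $Q_{a,b}(x)\le Q_{a,b}^{[S,1]}(x)$ if $b\le 1$, and $Q_{a,b}(x)\ge Q_{a,b}^{[S,1]}(x)$ if $b\ge 1$; \item $Q_{a,b}(x)\ge Q_{a,b}^{[S,2]}(x)$ if $b\le 1$, and $Q_{a,b}(x)\le Q_{a,b}^{[S,2]}(x)$ if $b\ge 1$. \end{itemize}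
   Context: The two expressions defining $Q_{a,b}^{[S,2]}$ agree at $x=p$. *)

(* Defs.v *)
From mathcomp Require Import all_boot all_order all_algebra.
From mathcomp Require Import all_classical all_reals all_analysis.
Set Implicit Arguments.
Unset Strict Implicit.
Unset Printing Implicit Defensive.
Import Order.TTheory GRing.Theory Num.Theory.
Import numFieldNormedType.Exports.
Local Open Scope classical_set_scope.
Local Open Scope ring_scope.

Definition p_ab (R : realType) (a b : R) : R := a / (a + b).

Definition c_ab (R : realType) (a b : R) : R := (a + b) / (a + 1).

(* Lebesgue integral: for a < 1 the integrand is unbounded near y = 0, but it
   is nonnegative and integrable when 0 < a and 0 <= x < 1, so that the
   real-valued integral is the genuine one. The value [0 `^ (a - 1)] at the
   endpoint y = 0 is immaterial. *)
Definition Qab (R : realType) (a b x : R) : R :=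
  a * \int[@lebesgue_measure R]_(y in `[0, 1])
        (y `^ (a - 1) * (1 - x * y) `^ (b - 1)).

Definition QabS1 (R : realType) (a b x : R) : R :=
  (1 - x) `^ b * (1 + c_ab a b * x / (1 - x)).

(* The two branches agree at x = p, where 1 - c * p = 1 / (a + 1). *)
Definition QabS2 (R : realType) (a b x : R) : R :=
  if x <= p_ab a b then (1 - x) `^ b / (1 - c_ab a b * x)
  else (a + 1) * (1 - p_ab a b) `^ b.

(* Main.v *)
Require Import Defs.
From mathcomp Require Import all_boot all_order all_algebra.
From mathcomp Require Import all_classical all_reals all_analysis.
From mathcomp Require Import measurable_realfun ring lra.
Import Order.TTheory GRing.Theory Num.Theory.
Import numFieldNormedType.Exports.
Local Open Scope classical_set_scope.
Local Open Scope ring_scope.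

(** Write [q y = a y^(a-1) (1 - x y)^(b-1)], so that [Q(x)] is the integral of
[q] over [0, 1]. The bounds come from explicit comparison primitives: put
[F y = y^a g y] with [g y] the value at [x y] of the formula for the bound.
Then [F 0 = 0], [F 1] is the bound at [x], and
[F' y = y^(a-1) (a g y + y g' y)]. With [c = (a+b)/(a+1)], the difference
[F' - q] is an explicit nonnegative function times [1 - b] for the first bound
([S1_defect]) and times [b - 1] for the second ([S2_defect]). Integrating the
sign of [F' - q] gives every inequality, except the second bound for [x > p],
where the formula [(1-x)^b / (1-cx)] is replaced by its value at [p]. There [Q]
is compared with [Q(p)]: the factor [(1 - x y)^(b-1)] is monotone in [x],
nondecreasing if [b <= 1] and nonincreasing if [b >= 1], in both cases in the
direction in which a constant bound extends to the right of [p].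

When [a < 1] the integrand is unbounded at [0]. The integration step is
therefore done between [e] and [1], and [e] is sent to [0], the integrals
converging by monotone convergence ([increment_le_improper],
[improper_le_increment]). All estimates are proved for the integral as an
extended real ([beta_integral]); since for each [b] an upper bound is among
them, finiteness comes for free and the estimates pass to the real number
[Q(x)] ([Qab_between]). *)

(** * Comparing an increment with an integral *)

Lemma is_derive_continuous {R : realType} [f : R -> R] [x d : R] :
  is_derive x 1 f d -> {for x, continuous f}.
Proof. by move=> [df _]; apply/differentiable_continuous/derivable1_diffP. Qed.

Lemma continuous_integrable_itv {R : realType} [f : R -> R] [e u : R] :
  (forall y : R, y \in `[e, u] -> {for y, continuous f}) ->
  (@lebesgue_measure R).-integrable `[e, u] (EFin \o f).
Proof.
move=> cf; apply: continuous_compact_integrable; first exact: segment_compact.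
apply/continuous_in_subspaceT => y yi; apply: cf.
by move: yi; rewrite inE.
Qed.

(** The function [G - F], with [G] the indefinite integral of [f], has the
nonnegative derivative [f - dF]. Working with [G] avoids assuming that [dF] is
continuous or integrable. *)
Lemma increment_le_integral {R : realType} [f F dF : R -> R] [e u : R] :
  e < u ->
  (forall y : R, y \in `[e, u] -> {for y, continuous f}) ->
  (forall y : R, y \in `[e, u] -> is_derive y 1 F (dF y)) ->
  (forall y : R, y \in `]e, u[ -> dF y <= f y) ->
  F u - F e <= \int[@lebesgue_measure R]_(y in `[e, u]) f y.
Proof.
move=> eu cf dFE le_dF.
have fint := continuous_integrable_itv cf.
pose G y := parameterized_integral (@lebesgue_measure R) e y f.
have dG y : y \in `]e, u[ -> derivable G y 1 /\ derive1 G y = f y.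
  move=> yeu; have := yeu; rewrite in_itv /= => /andP[ey yu].
  apply: continuous_FTC1 => //=; first exact: yu.
    exact: fint.
  by apply: cf; apply: subset_itv_oo_cc.
have dK y : y \in `]e, u[ -> is_derive y 1 (G \- F) (f y - dF y).
  move=> yeu; have [Gy GE] := dG y yeu.
  have Fy : is_derive y 1 F (dF y) by apply: dFE; apply: subset_itv_oo_cc.
  have Gy' : is_derive y 1 G (f y).
    by apply: DeriveDef; [exact: Gy|rewrite -derive1E; exact: GE].
  exact: is_deriveB.
have cK : {within `[e, u], continuous (G \- F)}.
  have cG : {within `[e, u], continuous G}.
    exact: parameterized_integral_continuous (ltW eu) fint.
  have cF : {within `[e, u], continuous F}.
    apply: derivable_within_continuous => z zeu.
    by apply: ex_derive; exact: dFE.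
  by move=> y; apply: continuousB; [exact: cG|exact: cF].
have := @ger0_derive1_le_cc R (G \- F) e u.
move=> /(_ _ _ cK e u); rewrite !in_itv /= !lexx (ltW eu) /= => H.
have : (G \- F) e <= (G \- F) u.
  apply: H => //= y yeu; have := dK y yeu.
    by move=> ?; apply: ex_derive.
  by move=> ?; rewrite derive1E derive_val subr_ge0 le_dF.
rewrite /= {1}/G /parameterized_integral set_itv1 Rintegral_set1 sub0r.
rewrite -/(parameterized_integral _ e u f) -/(G u); lra.
Qed.

Lemma integral_le_increment {R : realType} [f F dF : R -> R] [e u : R] :
  e < u ->
  (forall y : R, y \in `[e, u] -> {for y, continuous f}) ->
  (forall y : R, y \in `[e, u] -> is_derive y 1 F (dF y)) ->
  (forall y : R, y \in `]e, u[ -> f y <= dF y) ->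
  \int[@lebesgue_measure R]_(y in `[e, u]) f y <= F u - F e.
Proof.
move=> eu cf dFE le_dF.
have := @increment_le_integral R (fun y => - f y) (fun y => - F y)
   (fun y => - dF y) e u eu.
have -> : \int[@lebesgue_measure R]_(y in `[e, u]) (- f y) =
    - \int[@lebesgue_measure R]_(y in `[e, u]) f y.
  rewrite -[RHS]mulN1r -RintegralZl//; last exact: continuous_integrable_itv.
  by apply: eq_Rintegral => y _; rewrite mulN1r.
rewrite -opprD lerN2; apply => y yi.
- by apply: cvgN; exact: cf.
- by have ? := dFE y yi; apply: is_deriveN.
- by rewrite lerN2 le_dF.
Qed.

(** * The same comparison for an improper integral at 0 *)

Section improper.
Context {R : realType}.
Variables (f F dF : R -> R) (u : R).
Hypothesis u0 : 0 < u.
Hypothesis f0 : forall y : R, y \in `]0, u] -> 0 <= f y.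
Hypothesis cf : forall y : R, y \in `]0, u] -> {for y, continuous f}.
Hypothesis dFE : forall y : R, y \in `]0, u] -> is_derive y 1 F (dF y).
Hypothesis F0 : F y @[y --> 0^'+] --> F 0.

Lemma measurable_oc : measurable_fun `]0, u] f.
Proof.
apply: subspace_continuous_measurable_fun => //.
by apply: continuous_in_subspaceT => y; rewrite inE; exact: cf.
Qed.

(** Monotone convergence: the intervals from [1/(n+1)] to [u] exhaust the
half-open interval, which differs from the closed one by a null set. *)
Lemma integral_cvg :
  (\int[@lebesgue_measure R]_(y in `[(n.+1%:R^-1)%R, u]) (f y)%:E)%E
    @[n --> \oo] --> (\int[@lebesgue_measure R]_(y in `[0%R, u]) (f y)%:E)%E.
Proof.
rewrite -integral_itv_obnd_cbnd; last first.
  by apply/measurable_EFinP; exact: measurable_oc.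
rewrite itv_open_bnd_bigcup.
under eq_bigcupr do rewrite add0r.
apply: ge0_nondecreasing_set_cvg_integral => //.
- apply/nondecreasing_seqP => n; rewrite subsetEset; apply: subset_itvr.
  by rewrite bnd_simp lef_pV2 ?posrE// ler_nat.
- move=> n; apply/measurable_EFinP; apply: measurable_funS measurable_oc => //.
  by apply: subset_itvr; rewrite bnd_simp.
- move=> n y /=; rewrite in_itv/= => /andP[ny yu]; rewrite lee_fin f0//.
  by rewrite in_itv/= yu andbT; apply: lt_le_trans ny.
Qed.

Lemma increment_cvg : (F u - F n.+1%:R^-1)%:E @[n --> \oo] --> (F u - F 0)%:E.
Proof.
apply: cvg_EFin; first exact: nearW.
apply: cvgB; first exact: cvg_cst.
have /cvg_at_rightP := F0; apply; split => //.
exact: cvg_harmonic.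
Qed.

(** Only eventually: the first intervals from [1/(n+1)] to [u] may be empty. *)
Lemma near_harmonic_itv : \forall n \near \oo, 0 < (n.+1%:R^-1 : R) < u.
Proof.
have /cvgrPdist_lt/(_ u u0) := @cvg_harmonic R.
by apply: filterS => n; rewrite sub0r normrN ger0_norm
  ?invr_gt0 ?invr_ge0//= ltr0n.
Qed.

Lemma subset_itvcc_oc (e : R) : 0 < e -> {subset `[e, u] <= `]0, u]}.
Proof.
by move=> e0 y; rewrite !in_itv/= => /andP[ey ->]; rewrite andbT (lt_le_trans e0).
Qed.

Lemma integral_cc_fin (e : R) : 0 < e ->
  (\int[@lebesgue_measure R]_(y in `[e, u]) (f y)%:E)%E =
  (\int[@lebesgue_measure R]_(y in `[e, u]) f y)%:E.
Proof.
move=> e0; rewrite /Rintegral fineK//; apply: integrable_fin_num => //.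
by apply: continuous_integrable_itv => y yi; apply: cf; exact: subset_itvcc_oc yi.
Qed.

(** In extended reals, because a lower bound leaves open that the integral is
infinite. *)
Lemma increment_le_improper : (forall y : R, y \in `]0, u] -> dF y <= f y) ->
  ((F u - F 0)%:E <= \int[@lebesgue_measure R]_(y in `[0%R, u]) (f y)%:E)%E.
Proof.
move=> le_dF.
have le_e (e : R) : 0 < e < u -> ((F u - F e)%:E <=
    \int[@lebesgue_measure R]_(y in `[e, u]) (f y)%:E)%E.
  move=> /andP[e0 eu]; have sub := subset_itvcc_oc _ e0.
  rewrite integral_cc_fin// lee_fin.
  have cfe (y : R) (yi : y \in `[e, u]) := cf y (sub y yi).
  have dFe (y : R) (yi : y \in `[e, u]) := dFE y (sub y yi).
  have le_dFe (y : R) : y \in `]e, u[ -> dF y <= f y.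
    by move=> yi; apply/le_dF/sub/subset_itv_oo_cc.
  exact: increment_le_integral eu cfe dFe le_dFe.
rewrite -(cvg_lim _ increment_cvg)// -(cvg_lim _ integral_cvg)//.
apply: lee_lim; [exact: cvgP increment_cvg|exact: cvgP integral_cvg|].
by apply: filterS near_harmonic_itv => n /le_e.
Qed.

(** This bound is also what shows that the improper integral is finite. *)
Lemma improper_le_increment : (forall y : R, y \in `]0, u] -> f y <= dF y) ->
  (\int[@lebesgue_measure R]_(y in `[0%R, u]) (f y)%:E <= (F u - F 0)%:E)%E.
Proof.
move=> le_dF.
have le_e (e : R) : 0 < e < u -> (\int[@lebesgue_measure R]_(y in `[e, u]) (f y)%:E
    <= (F u - F e)%:E)%E.
  move=> /andP[e0 eu]; have sub := subset_itvcc_oc _ e0.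
  rewrite integral_cc_fin// lee_fin.
  have cfe (y : R) (yi : y \in `[e, u]) := cf y (sub y yi).
  have dFe (y : R) (yi : y \in `[e, u]) := dFE y (sub y yi).
  have le_dFe (y : R) : y \in `]e, u[ -> f y <= dF y.
    by move=> yi; apply/le_dF/sub/subset_itv_oo_cc.
  exact: integral_le_increment eu cfe dFe le_dFe.
rewrite -(cvg_lim _ increment_cvg)// -(cvg_lim _ integral_cvg)//.
apply: lee_lim; [exact: cvgP integral_cvg|exact: cvgP increment_cvg|].
by apply: filterS near_harmonic_itv => n /le_e.
Qed.

End improper.

(** * The kernel and its comparison primitives *)

Section beta_primitives.
Context {R : realType}.
Variables (a b x : R).
Hypotheses (a0 : 0 < a) (x0 : 0 <= x) (x1 : x < 1).

Definition beta_integrand (y : R) := a * (y `^ (a - 1) * (1 - x * y) `^ (b - 1)).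

Definition beta_integral :=
  (\int[@lebesgue_measure R]_(y in `[0%R, 1%R]) (beta_integrand y)%:E)%E.

Lemma base_gt0 (y : R) : y <= 1 -> 0 < 1 - x * y.
Proof. by move=> y1; rewrite subr_gt0 (le_lt_trans _ x1)// ler_piMr. Qed.

Lemma beta_integrand_ge0 (y : R) : 0 <= beta_integrand y.
Proof. by rewrite /beta_integrand !mulr_ge0 ?powR_ge0// ltW. Qed.

Lemma is_derive_base (y : R) : is_derive y 1 (fun y : R => 1 - x * y) (- x).
Proof.
apply: is_derive_eq.
by rewrite !(scaler0, add0r, addr0) scaler1; ring.
Qed.

Lemma is_derive_base_powR (s : R) (y : R) : y <= 1 ->
  is_derive y 1 (fun y : R => (1 - x * y) `^ s) (s * (1 - x * y) `^ (s - 1) * - x).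
Proof.
move=> y1.
exact: (@is_derive1_comp R (fun z : R => z `^ s) (fun y : R => 1 - x * y) y _ _
  (is_derive1_powR s (base_gt0 y y1)) (is_derive_base y)).
Qed.

Lemma beta_integrand_continuous (y : R) : 0 < y -> y <= 1 ->
  {for y, continuous beta_integrand}.
Proof.
move=> y0 y1; apply: cvgM; first exact: cvg_cst.
apply: cvgM.
  exact: is_derive_continuous (is_derive1_powR (a - 1) y0).
exact: is_derive_continuous (is_derive_base_powR _ _ y1).
Qed.

Lemma measurable_beta_integrand : measurable_fun setT beta_integrand.
Proof.
apply: measurable_funM => //; apply: measurable_funM; first exact: measurable_powR.
apply: (measurableT_comp (measurable_powR _)).
apply: measurable_funB => //; exact: measurable_funM.
Qed.

(** The factor [a] can be moved inside even when the integral is infinite,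
because [fine] then sends both integrals to [0]. *)
Lemma QabE : Qab a b x = fine beta_integral.
Proof.
rewrite /Qab /Rintegral.
have -> : beta_integral = (a%:E * \int[@lebesgue_measure R]_(y in `[0%R, 1%R])
    (y `^ (a - 1) * (1 - x * y) `^ (b - 1))%:E)%E.
  rewrite -ge0_integralZl//.
  - apply/measurable_EFinP; apply: measurable_funM.
      by apply: measurable_funTS; exact: measurable_powR.
    apply: measurable_funTS.
    apply: (measurableT_comp (measurable_powR _)).
    by apply: measurable_funB => //; exact: measurable_funM.
  - by move=> y _; rewrite lee_fin mulr_ge0 ?powR_ge0.
  - by rewrite lee_fin ltW.
case: (\int[_]_(_ in _) _)%E => [r||] //=.
  by rewrite gt0_muley ?lte_fin//= mulr0.
by rewrite gt0_muleNy ?lte_fin//= mulr0.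
Qed.

Lemma primitive_cvg0 (g : R -> R) : {for 0, continuous g} ->
  y `^ a * g y @[y --> 0^'+] --> (0 `^ a * g 0).
Proof.
move=> cg; rewrite powR0 ?gt_eqF//.
apply: cvgM; first exact: powR_cvg0.
exact: cvg_at_right_filter.
Qed.

Lemma is_derive_primitive (g : R -> R) (dg y : R) : 0 < y ->
  is_derive y 1 g dg ->
  is_derive y 1 (fun y : R => y `^ a * g y) (y `^ (a - 1) * (a * g y + y * dg)).
Proof.
move=> y0 dgy; have dy := is_derive1_powR a y0.
apply: is_derive_eq.
rewrite -(mulr_powRB1 (ltW y0) a0).
set P := y `^ _; rewrite -![_ *: _]/(_ * _); ring.
Qed.

(** Comparison with the primitive [y^a g y], after dividing by the common
factor [y^(a-1)]: what is left to check is a first-order differential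
inequality for [g]. *)
Lemma beta_integral_ge_of_deriv (g dg : R -> R) :
  (forall y : R, 0 <= y <= 1 -> is_derive y 1 g (dg y)) ->
  (forall y : R, 0 < y <= 1 -> a * g y + y * dg y <= a * (1 - x * y) `^ (b - 1)) ->
  ((g 1)%:E <= beta_integral)%E.
Proof.
move=> dgE le_g.
have -> : (g 1)%:E = ((fun y : R => y `^ a * g y) 1
    - (fun y : R => y `^ a * g y) 0)%:E.
  by rewrite /= powR1 powR0 ?gt_eqF// mul0r subr0 mul1r.
pose P (y : R) := y `^ (a - 1) * (a * g y + y * dg y).
have f0 (y : R) : y \in `]0, 1] -> 0 <= beta_integrand y.
  by move=> _; exact: beta_integrand_ge0.
have cf (y : R) : y \in `]0, 1] -> {for y, continuous beta_integrand}.
  by rewrite in_itv/= => /andP[]; exact: beta_integrand_continuous.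
have dF (y : R) : y \in `]0, 1] -> is_derive y 1 (fun y : R => y `^ a * g y) (P y).
  rewrite in_itv/= => /andP[y0 y1]; apply: is_derive_primitive => //.
  by apply: dgE; rewrite ltW.
have F0 : y `^ a * g y @[y --> 0^'+] --> 0 `^ a * g 0.
  by apply: primitive_cvg0; apply: is_derive_continuous (dgE _ _);
    rewrite lexx ler01.
have le_P (y : R) : y \in `]0, 1] -> P y <= beta_integrand y.
  rewrite in_itv/= => yi; rewrite /beta_integrand mulrCA.
  by apply: ler_wpM2l; rewrite ?powR_ge0// le_g.
exact: increment_le_improper ltr01 f0 cf dF F0 le_P.
Qed.

Lemma beta_integral_le_of_deriv (g dg : R -> R) :
  (forall y : R, 0 <= y <= 1 -> is_derive y 1 g (dg y)) ->
  (forall y : R, 0 < y <= 1 -> a * (1 - x * y) `^ (b - 1) <= a * g y + y * dg y) ->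
  (beta_integral <= (g 1)%:E)%E.
Proof.
move=> dgE le_g.
have -> : (g 1)%:E = ((fun y : R => y `^ a * g y) 1
    - (fun y : R => y `^ a * g y) 0)%:E.
  by rewrite /= powR1 powR0 ?gt_eqF// mul0r subr0 mul1r.
pose P (y : R) := y `^ (a - 1) * (a * g y + y * dg y).
have f0 (y : R) : y \in `]0, 1] -> 0 <= beta_integrand y.
  by move=> _; exact: beta_integrand_ge0.
have cf (y : R) : y \in `]0, 1] -> {for y, continuous beta_integrand}.
  by rewrite in_itv/= => /andP[]; exact: beta_integrand_continuous.
have dF (y : R) : y \in `]0, 1] -> is_derive y 1 (fun y : R => y `^ a * g y) (P y).
  rewrite in_itv/= => /andP[y0 y1]; apply: is_derive_primitive => //.
  by apply: dgE; rewrite ltW.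
have F0 : y `^ a * g y @[y --> 0^'+] --> 0 `^ a * g 0.
  by apply: primitive_cvg0; apply: is_derive_continuous (dgE _ _);
    rewrite lexx ler01.
have le_P (y : R) : y \in `]0, 1] -> beta_integrand y <= P y.
  rewrite in_itv/= => yi; rewrite /beta_integrand mulrCA.
  by apply: ler_wpM2l; rewrite ?powR_ge0// le_g.
exact: improper_le_increment ltr01 f0 cf dF F0 le_P.
Qed.

End beta_primitives.

(** * The two bounds *)

Section bounds.
Context {R : realType}.
Variables (a b : R).
Hypotheses (a0 : 0 < a) (b0 : 0 < b).
Let c := c_ab a b.
Let p := p_ab a b.

Lemma c_ab_gt0 : 0 < c.
Proof. by rewrite divr_gt0 ?addr_gt0. Qed.

Lemma p_ab_ge0 : 0 <= p.
Proof. by rewrite divr_ge0 ?addr_ge0// ltW. Qed.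

Lemma p_ab_lt1 : p < 1.
Proof. by rewrite ltr_pdivrMr ?addr_gt0// mul1r ltrDl. Qed.

Lemma one_sub_cp : 1 - c * p = (a + 1)^-1.
Proof. by rewrite /c /p /c_ab /p_ab; field; rewrite !gt_eqF ?addr_gt0. Qed.

Section fixed_x.
Variable x : R.
Hypotheses (x0 : 0 <= x) (x1 : x < 1).

Lemma base_powRS (s y : R) : y <= 1 ->
  (1 - x * y) `^ (s - 1) * (1 - x * y) = (1 - x * y) `^ s.
Proof.
move=> y1; have h := base_gt0 x x0 x1 y y1.
by rewrite -{2}[1 - x * y]powRr1 ?(ltW h)// -powRD ?subrK// (gt_eqF h) implybT.
Qed.

(** The first bound evaluated at [x y], with a factor [1 - x y] cancelled. *)
Definition S1_scaled (y : R) := (1 - x * y) `^ (b - 1) * (1 + (c - 1) * x * y).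
Definition dS1_scaled (y : R) :=
  (b - 1) * (1 - x * y) `^ (b - 1 - 1) * - x * (1 + (c - 1) * x * y)
  + (1 - x * y) `^ (b - 1) * ((c - 1) * x).

Lemma is_derive_S1_scaled (y : R) : y <= 1 ->
  is_derive y 1 S1_scaled (dS1_scaled y).
Proof.
move=> y1; have h1 := is_derive_base_powR x x0 x1 (b - 1) y y1.
have h2 : is_derive y 1 (fun y : R => 1 + (c - 1) * x * y) ((c - 1) * x).
  apply: is_derive_eq; rewrite !(scaler0, add0r, addr0) scaler1; ring.
have h3 := is_deriveM h1 h2.
by apply: is_derive_eq; rewrite /dS1_scaled -![_ *: _]/(_ * _); ring.
Qed.

Lemma S1_scaledE : S1_scaled 1 = QabS1 a b x.
Proof.
rewrite /S1_scaled /QabS1 -/c -(mulr1 x) -(base_powRS b 1 (lexx 1)) !mulr1.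
by field; rewrite gt_eqF// subr_gt0.
Qed.

(** The terms of order 0 and 1 in [x y] cancel: this is what singles out the
value of [c]. *)
Lemma S1_defect (y : R) : y <= 1 ->
  a * S1_scaled y + y * dS1_scaled y - a * (1 - x * y) `^ (b - 1) =
  - (b - 1) * (c * (x * y) ^+ 2 * (1 - x * y) `^ (b - 1 - 1)).
Proof.
move=> y1; rewrite /S1_scaled /dS1_scaled -(base_powRS (b - 1) y y1).
rewrite /c /c_ab; set W := _ `^ _.
by field; rewrite gt_eqF ?addr_gt0.
Qed.

Lemma S1_weight_ge0 (y : R) : 0 <= c * (x * y) ^+ 2 * (1 - x * y) `^ (b - 1 - 1).
Proof. by rewrite mulr_ge0 ?powR_ge0// mulr_ge0 ?sqr_ge0// ltW// c_ab_gt0. Qed.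

Lemma beta_integral_le_S1 : b <= 1 ->
  (beta_integral a b x <= (QabS1 a b x)%:E)%E.
Proof.
move=> b1; rewrite -S1_scaledE.
apply: (beta_integral_le_of_deriv a b x a0 x0 x1 S1_scaled dS1_scaled)
  => y /andP[_ y1].
  exact: is_derive_S1_scaled.
by rewrite -subr_ge0 S1_defect// mulr_ge0 ?S1_weight_ge0// oppr_ge0 subr_le0.
Qed.

Lemma beta_integral_ge_S1 : 1 <= b ->
  ((QabS1 a b x)%:E <= beta_integral a b x)%E.
Proof.
move=> b1; rewrite -S1_scaledE.
apply: (beta_integral_ge_of_deriv a b x a0 x0 x1 S1_scaled dS1_scaled)
  => y /andP[_ y1].
  exact: is_derive_S1_scaled.
by rewrite -subr_le0 S1_defect// mulNr oppr_le0 mulr_ge0 ?S1_weight_ge0// subr_ge0.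
Qed.

(** The lower branch of the second bound evaluated at [x y]. *)
Definition S2_scaled (y : R) := (1 - x * y) `^ b * (1 - c * x * y)^-1.
Definition dS2_scaled (y : R) :=
  b * (1 - x * y) `^ (b - 1) * - x * (1 - c * x * y)^-1
  + (1 - x * y) `^ b * (c * x / (1 - c * x * y) ^+ 2).

Hypothesis xp : x <= p.

(** The restriction [x <= p] enters here: [1 - c x y >= 1 - c p > 0]. *)
Lemma S2_denom_gt0 (y : R) : 0 <= y <= 1 -> 0 < 1 - c * x * y.
Proof.
move=> /andP[y0 y1].
have h : 0 < 1 - c * p by rewrite one_sub_cp invr_gt0 addr_gt0.
apply: lt_le_trans h _; rewrite lerB// -mulrA ler_wpM2l ?(ltW c_ab_gt0)//.
by rewrite (le_trans _ xp)// ler_piMr.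
Qed.

Lemma is_derive_S2_scaled (y : R) : 0 <= y <= 1 ->
  is_derive y 1 S2_scaled (dS2_scaled y).
Proof.
move=> yi; have h0 := S2_denom_gt0 y yi; have /andP[y0 y1] := yi.
have h1 := is_derive_base_powR x x0 x1 b y y1.
have h2 : is_derive y 1 (fun y : R => 1 - c * x * y) (- (c * x)).
  apply: is_derive_eq; rewrite !(scaler0, add0r, addr0) scaler1; ring.
have h2' := @is_deriveV R (fun y : R => 1 - c * x * y) y _ 1 (lt0r_neq0 h0) h2.
have h3 := is_deriveM h1 h2'.
apply: is_derive_eq; rewrite /dS2_scaled -![_ *: _]/(_ * _) -exprVn.
ring.
Qed.

Lemma S2_scaledE : S2_scaled 1 = QabS2 a b x.
Proof. by rewrite /S2_scaled /QabS2 -/p xp !mulr1. Qed.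

(** The same cancellation, from [a (c - 1) - b = - c]. The factor [c - 1] that
remains is [(b - 1) / (a + 1)]. *)
Lemma S2_defect (y : R) : 0 <= y <= 1 ->
  a * S2_scaled y + y * dS2_scaled y - a * (1 - x * y) `^ (b - 1) =
  (b - 1) * ((x * y / (1 - c * x * y)) ^+ 2 * (c / (a + 1)) * (1 - x * y) `^ (b - 1)).
Proof.
move=> yi; have h0 := S2_denom_gt0 y yi; have /andP[y0 y1] := yi.
rewrite /S2_scaled /dS2_scaled -(base_powRS b y y1).
move: h0; rewrite /c /c_ab; set W := _ `^ _ => h0.
have h1 : a + 1 != 0 by rewrite gt_eqF ?addr_gt0.
(* [field] clears [c = (a + b) / (a + 1)], leaving this scaled denominator. *)
have h2 : a + 1 - (a + b) * x * y != 0.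
  have -> : a + 1 - (a + b) * x * y = (a + 1) * (1 - (a + b) / (a + 1) * x * y).
    by field.
  by rewrite mulf_neq0// gt_eqF.
by field; rewrite h1.
Qed.

Lemma S2_weight_ge0 (y : R) :
  0 <= (x * y / (1 - c * x * y)) ^+ 2 * (c / (a + 1)) * (1 - x * y) `^ (b - 1).
Proof.
by rewrite mulr_ge0 ?powR_ge0// mulr_ge0 ?sqr_ge0// ltW// divr_gt0 ?c_ab_gt0 ?addr_gt0.
Qed.

Lemma beta_integral_ge_S2_left : b <= 1 ->
  ((QabS2 a b x)%:E <= beta_integral a b x)%E.
Proof.
move=> b1; rewrite -S2_scaledE.
apply: (beta_integral_ge_of_deriv a b x a0 x0 x1 S2_scaled dS2_scaled) => y yi.
  exact: is_derive_S2_scaled.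
have {}yi : 0 <= y <= 1 by case/andP: yi => /ltW -> ->.
by rewrite -subr_le0 S2_defect// mulr_le0_ge0 ?S2_weight_ge0// subr_le0.
Qed.

Lemma beta_integral_le_S2_left : 1 <= b ->
  (beta_integral a b x <= (QabS2 a b x)%:E)%E.
Proof.
move=> b1; rewrite -S2_scaledE.
apply: (beta_integral_le_of_deriv a b x a0 x0 x1 S2_scaled dS2_scaled) => y yi.
  exact: is_derive_S2_scaled.
have {}yi : 0 <= y <= 1 by case/andP: yi => /ltW -> ->.
by rewrite -subr_ge0 S2_defect// mulr_ge0 ?S2_weight_ge0// subr_ge0.
Qed.

End fixed_x.

(** Both branches equal [(a + 1) (1 - p)^b] at [p], so the bound is constant to
the right of [p]. *)
Lemma QabS2_const (x : R) : p <= x -> QabS2 a b x = QabS2 a b p.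
Proof.
rewrite {2}/QabS2 -/p lexx one_sub_cp invrK mulrC => px.
rewrite /QabS2 -/p; case: ifPn => // xp.
have -> : x = p by apply/eqP; rewrite eq_le xp.
by rewrite one_sub_cp invrK mulrC.
Qed.

Lemma ler_powR_neg (s u v : R) : s <= 0 -> 0 < u -> u <= v -> v `^ s <= u `^ s.
Proof.
move=> s0 u0 uv; have v0 := lt_le_trans u0 uv.
rewrite -[s]opprK (powRN v) (powRN u) lef_pV2 ?posrE ?powR_gt0//.
by rewrite ge0_ler_powR ?oppr_ge0 ?nnegrE// ltW.
Qed.

Lemma beta_integral_monotone (x x' : R) :
  (forall y : R, 0 <= y <= 1 -> (1 - x * y) `^ (b - 1) <= (1 - x' * y) `^ (b - 1)) ->
  (beta_integral a b x <= beta_integral a b x')%E.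
Proof.
move=> le_xx'; apply: ge0_le_integral => //.
- by move=> y _; rewrite lee_fin beta_integrand_ge0.
- apply/measurable_EFinP; apply: measurable_funTS.
  exact: measurable_beta_integrand.
- apply/measurable_EFinP; apply: measurable_funTS.
  exact: measurable_beta_integrand.
- move=> y; rewrite /= in_itv/= => yi; rewrite lee_fin /beta_integrand.
  by rewrite !ler_wpM2l ?powR_ge0 ?(ltW a0)// le_xx'.
Qed.

Lemma beta_integral_ge_S2 (x : R) : 0 <= x -> x < 1 -> b <= 1 ->
  ((QabS2 a b x)%:E <= beta_integral a b x)%E.
Proof.
move=> x0 x1 b1; have [xp|/ltW px] := leP x p.
  exact: beta_integral_ge_S2_left.
rewrite QabS2_const//.
apply: le_trans (beta_integral_ge_S2_left p p_ab_ge0 p_ab_lt1 (lexx p) b1) _.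
apply: beta_integral_monotone => y /andP[y0 y1]; apply: ler_powR_neg.
- by rewrite subr_le0.
- exact: base_gt0.
- by rewrite lerB// ler_wpM2r.
Qed.

Lemma beta_integral_le_S2 (x : R) : 0 <= x -> x < 1 -> 1 <= b ->
  (beta_integral a b x <= (QabS2 a b x)%:E)%E.
Proof.
move=> x0 x1 b1; have [xp|/ltW px] := leP x p.
  exact: beta_integral_le_S2_left.
rewrite QabS2_const//.
apply: le_trans (beta_integral_le_S2_left p p_ab_ge0 p_ab_lt1 (lexx p) b1).
apply: beta_integral_monotone => y /andP[y0 y1].
rewrite ge0_ler_powR ?subr_ge0 ?nnegrE//.
- by rewrite ltW// base_gt0.
- by rewrite ltW// base_gt0// ?p_ab_ge0// p_ab_lt1.
- by rewrite lerB// ler_wpM2r.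
Qed.

(** The upper bound makes the integral finite, so that [fine] loses nothing in
either inequality. *)
Lemma Qab_between (x L U : R) : (L%:E <= beta_integral a b x)%E ->
  (beta_integral a b x <= U%:E)%E -> L <= Qab a b x <= U.
Proof.
move=> leL leU; rewrite QabE//.
have fin : beta_integral a b x \is a fin_num.
  by rewrite fin_numE -ltey -ltNye (le_lt_trans leU) ?ltry// (lt_le_trans _ leL) ?ltNyr.
by rewrite -!lee_fin fineK// leL.
Qed.

End bounds.

Theorem theorem2p1 (R : realType) (a b : R) (ha : 0 < a) (hb : 0 < b)
    (x : R) (hx0 : 0 <= x) (hx1 : x < 1) :
  ((b <= 1 -> Qab a b x <= QabS1 a b x) /\
   (1 <= b -> QabS1 a b x <= Qab a b x)) /\
  ((b <= 1 -> QabS2 a b x <= Qab a b x) /\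
   (1 <= b -> Qab a b x <= QabS2 a b x)).
Proof.
have le1 (b1 : b <= 1) : QabS2 a b x <= Qab a b x <= QabS1 a b x.
  apply: Qab_between; first exact: ha.
    exact: beta_integral_ge_S2.
  exact: beta_integral_le_S1.
have ge1 (b1 : 1 <= b) : QabS1 a b x <= Qab a b x <= QabS2 a b x.
  apply: Qab_between; first exact: ha.
    exact: beta_integral_ge_S1.
  exact: beta_integral_le_S2.
by split; split=> [/le1|/ge1] /andP[].
Qed.
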